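(* Let $C$ be a normal cone with nonempty interior $\operatorname{int}C$ in a real Banach space $(X,\|\cdot\|)$. Let $f:\operatorname{int}C\to\operatorname{int}C$ be positively homogeneous ($f(tx)=tf(x)$ for all $t>0$) and order preserving ($x\le y$ implies $f(x)\le f(y)$). Let $S=\{x\in\operatorname{int}C\mid f(x)=x\}$, and assume that $v\in S$. Assume: (A1) $f$ is semidifferentiable at $v$, with semidifferential $f'_v:X\to X$; (A2) the map $\mathrm{Id}-f'_v:X\to X$ has Property (F); (A3) if $f'_v(x)=x$ for some $x\in X$, then $x\in\{\lambda v\mid\lambda\in\mathbb R\}$. Then $S=\{\lambda v\mid\lambda>0\}$.
   Context: Cones: a subset $C\subset X$ is a cone if $tC\subset C$ for all $t\ge0$. It is proper if it is closed, convex and pointed ($C\cap(-C)=\{0\}$); it then defines the partial order $x\le y\iff y-x\in C$. It is normal if it is proper and there is a constant $M$ with $\|x\|\le M\|y\|$ whenever $0\le x\le y$. Semidifferentiability: let $G\subset X$ and $v$ an interior point of $G$. A map $f:G\to X$ is semidifferentiable at $v$ if there exists a continuous, positively homogeneous map $h:X\to X$ (i.e. $h(tx)=th(x)$ for all $t>0$, $x\in X$) such that $f(v+x)=f(v)+h(x)+o(\|x\|)$ as $x\to0$. Such $h$ is unique and denoted $f'_v$ (the semidifferential of $f$ at $v$). Property (F): a map $g:D\to Y$, with $D\subset X$ and $X,Y$ Banach spaces, has Property (F) if every sequence $(x_j)_{j\ge1}$ in $D$ that is bounded in $X$ and satisfies $g(x_j)\to0$ has a subsequence that converges in $X$. *)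

(* Defs.v *)
From HB Require Import structures.
From mathcomp Require Import all_boot all_order all_algebra.
From mathcomp Require Import all_classical all_reals all_analysis.

Set Implicit Arguments.
Unset Strict Implicit.
Unset Printing Implicit Defensive.

Import Order.TTheory GRing.Theory Num.Theory.
Import numFieldNormedType.Exports.

Local Open Scope classical_set_scope.
Local Open Scope ring_scope.

(* A map f : D -> Y with D a subset of X is represented by a total function
   X -> Y together with the set D; its values outside D are unconstrained. *)

Section Cones.
Context {R : realType} {X : normedModType R}.
Implicit Types (C D : set X) (f : X -> X) (x y : X).

Definition is_cone C := forall (t : R) x, 0 <= t -> C x -> C (t *: x).

Definition pointed_cone C := C `&` [set - x | x in C] = [set 0].

Definition proper_cone C :=
  [/\ is_cone C, closed C, convex_set C & pointed_cone C].

Definition cone_le C x y := C (y - x).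

Definition normal_cone C :=
  proper_cone C /\
  exists M : R, forall x y,
    cone_le C 0 x -> cone_le C x y -> `|x| <= M * `|y|.

Definition positively_homogeneous D f :=
  forall (t : R) x, 0 < t -> D x -> f (t *: x) = t *: f x.

Definition order_preserving C D f :=
  forall x y, D x -> D y -> cone_le C x y -> cone_le C (f x) (f y).

Definition fixed_points D f := [set x | D x /\ f x = x].

(* Since v is interior to G, the expansion at 0 only involves the values of f
   on G. Such an h is unique. *)
Definition is_semidifferential (G : set X) f (v : X) (h : X -> X) :=
  [/\ interior G v, continuous h, positively_homogeneous setT h &
      forall x, f (v + x) = f v + h x +o_(x \near (0 : X)) x].

End Cones.

Definition property_F {R : realType} {X Y : completeNormedModType R}
    (D : set X) (g : X -> Y) :=
  forall u : nat -> X,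
    (forall j, D (u j)) -> bounded_fun u ->
    g (u j) @[j --> \oo] --> (0 : Y) ->
    exists2 s : nat -> nat, increasing_seq s & cvgn (u \o s).

(* Main.v *)
(* Suppose [v] and [w] are fixed points that are not proportional, scaled so
   that [v <= w] and [c w <= v] are optimal, with [c < 1]. For small [t], the
   set of all [x] with
     [v <= x <= w] and [(1 + t) c w <= x <= (1 + t) v]
   is convex, nonempty and invariant under [f]; its points lie between [v] and
   [w], at distance of order [t] from [v]. Since [f] is nonexpansive for order
   bounds, this set contains points [x] with [|x - f x| <= t^2]. By (A1) the
   quotients [u = (x - v) / t] satisfy [u - f'_v u -> 0], so by (A2) and (A3)
   they accumulate at some [lam v]. As [v] is an order unit, [x <= w] and the
   optimality of [v <= w] give [lam <= 0], whereas [(1 + t) c w <= x] and the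
   optimality of [c w <= v] give [lam >= 1]. *)

Require Import Defs.
From HB Require Import structures.
From mathcomp Require Import all_boot all_order all_algebra.
From mathcomp Require Import all_classical all_reals all_analysis.
From mathcomp Require Import ring lra.

Set Implicit Arguments.
Unset Strict Implicit.
Unset Printing Implicit Defensive.

Import Order.TTheory GRing.Theory Num.Theory.
Import numFieldNormedType.Exports.

Local Open Scope classical_set_scope.
Local Open Scope ring_scope.

(** Hiding the three vectors behind an abstract [e] lets sums, opposites and multiples act on
    coefficients only, so a vector identity reduces to three scalar ones for [ring] or [field]. *)
Lemma lin_comb (R : pzRingType) (X : lmodType R) (p q r : X) :
  exists e : R -> R -> R -> X,
    [/\ p = e 1 0 0, q = e 0 1 0 & r = e 0 0 1] /\
    [/\ forall a b c a' b' c', e a b c + e a' b' c' = e (a + a') (b + b') (c + c'),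
        forall a b c, - e a b c = e (- a) (- b) (- c) &
        forall t a b c, t *: e a b c = e (t * a) (t * b) (t * c)].
Proof.
exists (fun a b c => a *: p + b *: q + c *: r); split.
  by split; rewrite !scale0r ?scale1r ?addr0 ?add0r.
split=> *.
- by rewrite !scalerDl addrACA; congr (_ + _); rewrite addrACA.
- by rewrite !opprD !scaleNr.
- by rewrite !scalerDr !scalerA.
Qed.

(* Identities between linear combinations of three vectors are checked
   coefficientwise. The vectors are replaced from left to right, so [f x] must
   be listed before [x]. *)
Ltac lin p q r :=
  let e := fresh "e" in let hp := fresh in let hq := fresh in
  let hr := fresh in let hD := fresh in let hN := fresh in let hZ := fresh in
  have [e [[hp hq hr] [hD hN hZ]]] := lin_comb p q r;
  rewrite ?hp ?hq ?hr ?(hN, hZ, hD);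
  congr (e _ _ _).

(** * The order of a proper cone, order units and optimal scalars *)

Section ConeOrder.
Context {R : realType} {X : normedModType R}.
Variable C : set X.
Hypothesis Cp : proper_cone C.
Implicit Types (x y z v w : X) (a b t : R).

Lemma proper_coneZ t x : 0 <= t -> C x -> C (t *: x).
Proof. by case: Cp => + _ _ _ => /[apply]; apply. Qed.

(** The sum is twice the midpoint, which convexity puts in [C]. *)
Lemma proper_coneD x y : C x -> C y -> C (x + y).
Proof.
case: Cp => _ _ Cc _ Cx Cy.
have h0 : 0 <= 2^-1 :> R by rewrite invr_ge0.
have h1 : 2^-1 <= 1 :> R by rewrite invf_le1// ler1n.
have := Cc x y (Itv01 h0 h1); rewrite !inE => /(_ Cx Cy).
move=> /(@proper_coneZ 2 _ (ler0n _ _)).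
congr (C _); rewrite /conv /= /unstable.onem.
by lin x y (0 : X); field.
Qed.

Lemma cone_le_refl x : cone_le C x x.
Proof.
rewrite /cone_le subrr; case: Cp => _ _ _ /seteqP[_ /(_ 0)].
by case=> //=.
Qed.

Lemma cone_le_trans y x z : cone_le C x y -> cone_le C y z -> cone_le C x z.
Proof.
rewrite /cone_le => xy yz; have := proper_coneD xy yz; congr (C _).
by rewrite addrC subrKA.
Qed.

Lemma cone_le_anti x y : cone_le C x y -> cone_le C y x -> x = y.
Proof.
move=> xy yx; case: Cp => _ _ _ /seteqP[+ _] => /(_ (x - y)) /= h.
apply/eqP; rewrite -subr_eq0; apply/eqP/h; split => //.
by exists (y - x) => //; rewrite opprB.
Qed.

Lemma cone_leD x y z w :
  cone_le C x y -> cone_le C z w -> cone_le C (x + z) (y + w).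
Proof.
rewrite /cone_le => xy zw; have := proper_coneD xy zw; congr (C _).
by rewrite addrACA opprD.
Qed.

Lemma cone_leZ t x y : 0 <= t -> cone_le C x y -> cone_le C (t *: x) (t *: y).
Proof. by move=> t0 xy; rewrite /cone_le -scalerBr; apply: proper_coneZ. Qed.

Lemma cone_leZl a b x : a <= b -> C x -> cone_le C (a *: x) (b *: x).
Proof.
by move=> ab Cx; rewrite /cone_le -scalerBl; apply: proper_coneZ;
  rewrite ?subr_ge0.
Qed.

Lemma cone_le_conv t x y z w : 0 <= t <= 1 -> cone_le C x z -> cone_le C y w ->
  cone_le C ((1 - t) *: x + t *: y) ((1 - t) *: z + t *: w).
Proof.
by move=> /andP[t0 t1] xz yw; apply: cone_leD; apply: cone_leZ;
  rewrite ?subr_ge0.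
Qed.

Lemma interior_coneP x :
  interior C x <-> exists2 r, 0 < r & forall y, `|y| < r -> C (x + y).
Proof.
rewrite /interior /= -nbhs_ballE; split=> -[r /= r0 xr]; exists r => //.
  by move=> y yr; apply: xr; rewrite -ball_normE /ball_ /= opprD addNKr normrN.
move=> y; rewrite -ball_normE /ball_ /= distrC => /xr.
by rewrite subrKC.
Qed.

Lemma interior_cone_le x y : interior C x -> cone_le C x y -> interior C y.
Proof.
move=> /interior_coneP[r r0 xr] xy; apply/interior_coneP; exists r => // z zr.
have := proper_coneD (xr _ zr) xy; congr (C _).
by rewrite addrAC subrKC.
Qed.

Lemma interior_coneZ t x : 0 < t -> interior C x -> interior C (t *: x).
Proof.
move=> t0 /interior_coneP[r r0 xr]; apply/interior_coneP.
exists (t * r); first exact: mulr_gt0.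
move=> y yr; have /xr : `|t^-1 *: y| < r.
  by rewrite normrZ gtr0_norm ?invr_gt0// mulrC ltr_pdivrMr// [r * _]mulrC.
move=> /(proper_coneZ (ltW t0)); congr (C _).
by rewrite scalerDr scalerA divff ?gt_eqF// scale1r.
Qed.

Lemma interior_coneW x : interior C x -> C x.
Proof. exact: interior_subset. Qed.

(** If the ball of radius [r] around [v] lies in [C], then so does [v] minus [x] rescaled to norm
    [r / 2]; multiplying by [2 / r * |x|] gives the bound. *)
Lemma order_unit v : interior C v ->
  exists2 k, 0 < k & forall x, cone_le C x ((k * `|x|) *: v).
Proof.
move=> /interior_coneP[r r0 vr]; exists (2 / r); first exact: divr_gt0.
move=> x; have [->|x0] := eqVneq x 0.
  by rewrite normr0 mulr0 scale0r; apply: cone_le_refl.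
have nx : 0 < `|x| by rewrite normr_gt0.
have /vr : `|- (r / 2 / `|x|) *: x| < r.
  rewrite normrZ normrN gtr0_norm ?divr_gt0//.
  by rewrite divfK ?gt_eqF// ltr_pdivrMr// ltr_pMr// ltr1n.
have k0 : 0 <= 2 / r * `|x| by rewrite !mulr_ge0// invr_ge0 ltW.
move=> /(proper_coneZ k0); congr (C _).
move: `|x| nx {k0} => n n0.
by lin x v (0 : X); field; rewrite !gt_eqF.
Qed.

Lemma interior_coneN x : x != 0 -> interior C x -> ~ C (- x).
Proof.
move=> /eqP x0 /interior_coneW Cx Cnx; apply: x0.
by apply: cone_le_anti; rewrite /cone_le ?sub0r ?subr0.
Qed.

Lemma cone_leZl_inv a b v : v != 0 -> interior C v ->
  cone_le C (a *: v) (b *: v) -> a <= b.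
Proof.
move=> v0 vC ab; rewrite leNgt; apply/negP => ba.
apply: (interior_coneN v0 vC).
have c0 : 0 < a - b by rewrite subr_gt0.
move: ab; rewrite /cone_le -scalerBl.
move=> /(proper_coneZ (ltW (_ : 0 < (a - b)^-1))).
rewrite invr_gt0 => /(_ c0); congr (C _).
by rewrite scalerA -(opprB a) mulrN mulVf ?gt_eqF// scaleN1r.
Qed.

(** The admissible scalars form a closed set, as [C] is closed. It is bounded above because [v] is
    an order unit and has a positive element because [w] is one, so its supremum is attained. *)
Lemma best_lower_scalar v w : v != 0 -> interior C v -> interior C w ->
  exists a, [/\ 0 < a, cone_le C (a *: v) w &
    forall t, cone_le C (t *: v) w -> t <= a].
Proof.
move=> v0 vC wC; have [k k0 kv] := order_unit vC.
have [l l0 lw] := order_unit wC.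
pose A := [set t : R | cone_le C (t *: v) w].
have Cv := interior_coneW vC.
have ubA : ubound A (k * `|w|).
  by move=> t At; apply: (cone_leZl_inv v0 vC); apply: cone_le_trans At (kv w).
have nv : 0 < `|v| by rewrite normr_gt0.
have lv0 : 0 < l * `|v| by rewrite mulr_gt0.
have A0 : A (l * `|v|)^-1.
  have := cone_leZ (ltW (_ : 0 < (l * `|v|)^-1)) (lw v).
  by rewrite invr_gt0 => /(_ lv0); rewrite scalerA mulVf ?gt_eqF// scale1r.
have supA : has_sup A by split; [exists (l * `|v|)^-1|exists (k * `|w|)].
exists (sup A); split.
- apply: (@lt_le_trans _ _ (l * `|v|)^-1); rewrite ?invr_gt0//.
  by apply: ub_le_sup => //; exists (k * `|w|).
- have cA : closed A.
    have [_ Cc _ _] := Cp.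
    apply: (@preimage_closed _ _ (fun t : R => w - t *: v)) => // t _.
    by apply: cvgB; [exact: cvg_cst|apply: cvgZr_tmp; exact: cvg_id].
  by apply: cA; apply: closure_sup; case: supA.
- by move=> t At; apply: ub_le_sup => //; exists (k * `|w|).
Qed.
End ConeOrder.

(** Shifting by [y] gives [0 <= x + y <= 2 y], to which normality applies. Since [M] may be
    negative, [|M|] is used. *)
Lemma normal_cone_norm_le (R : realType) (X : normedModType R) (C : set X) :
  normal_cone C -> exists2 N : R, 0 < N &
    forall x y, cone_le C (- y) x -> cone_le C x y -> `|x| <= N * `|y|.
Proof.
case=> Cp [M nM]; exists (`|M| * 2 + 1).
  by rewrite ltr_wpDl// mulr_ge0.
move=> x y yx xy; have := nM (x + y) (y + y).
have h1 : cone_le C 0 (x + y) by move: yx; rewrite /cone_le subr0 opprK.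
have h2 : cone_le C (x + y) (y + y).
  by apply: cone_leD => //; apply: cone_le_refl.
move=> /(_ h1 h2) xyM.
have -> : x = (x + y) - y by rewrite addrK.
apply: (le_trans (ler_normB _ _)); rewrite mulrDl mul1r lerD2r.
apply: (le_trans xyM); rewrite -mulr2n normrMn -mulrA mulr_natl.
by apply: ler_wpM2r; rewrite ?mulrn_wge0// ler_norm.
Qed.

(** * Almost fixed points of order-preserving homogeneous maps *)

Lemma le0_expr_lt (R : realType) (k e : R) : 0 <= k -> k < 1 -> 0 < e ->
  exists n, k ^+ n < e.
Proof.
move=> k0 k1 e0; have /cvgr0Pnorm_lt/(_ e e0) [n _ /(_ n (leqnn n))] :
    (GRing.exp k : R^nat) x @[x --> \oo] --> 0.
  by apply: cvg_expr; rewrite ger0_norm.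
by rewrite /= ger0_norm ?exprn_ge0//; exists n.
Qed.

(* The averaged map [(1 - l) f + l z] contracts the order bounds
   [x <= (1 + c) y], so its iterates are almost fixed by it; they are almost
   fixed by [f] once [l] is small. *)
Lemma almost_fixed_point (R : realType) (X : normedModType R) (C : set X)
    (f : X -> X) (K : set X) (v z : X) (B e : R) :
  normal_cone C -> positively_homogeneous (interior C) f ->
  order_preserving C (interior C) f -> interior C v -> 1 <= B ->
  (forall x, K x -> cone_le C v x /\ cone_le C x (B *: v)) ->
  (forall t x y, 0 <= t <= 1 -> K x -> K y -> K ((1 - t) *: x + t *: y)) ->
  (forall x, K x -> K (f x)) -> K z -> 0 < e ->
  exists2 x, K x & `|x - f x| < e.
Proof.
move=> Cn f_hom f_mono vC B1 Kv Kconv Kf Kz e0.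
have [N N0 nN] := normal_cone_norm_le Cn; have [Cp _] := Cn.
have Cv := interior_coneW vC.
have B0 : 0 < B by apply: lt_le_trans B1.
have KC x : K x -> interior C x.
  by move=> /Kv[vx _]; apply: interior_cone_le vC vx.
have KB x y : K x -> K y -> cone_le C x (B *: y).
  move=> /Kv[_ xv] /Kv[vy _]; apply: cone_le_trans xv _ => //.
  by apply: cone_leZ => //; apply: ltW.
(* [P] bounds the norm of any vector between [- B ^+ 2 *: v] and [B ^+ 2 *: v]; [l] is then chosen
   so that [l * P < e / 2]. *)
pose P := N * (B ^+ 2 * `|v|).
have P0 : 0 <= P by rewrite !mulr_ge0// ltW.
pose l := e / (e + 2 * P).
have eP : 0 < e + 2 * P by rewrite ltr_wpDr// mulr_ge0.
have l0 : 0 < l by rewrite divr_gt0.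
have l1 : l <= 1 by rewrite ler_pdivrMr// mul1r lerDl mulr_ge0.
have lP : l * P < e / 2.
  by rewrite /l mulrAC ltr_pdivrMr// -subr_gt0 (_ : _ - _ = e ^+ 2 / 2);
    [rewrite divr_gt0// exprn_gt0|field].
pose k := B / (B + l).
have Bl : 0 < B + l by rewrite addr_gt0.
have k0 : 0 <= k by rewrite divr_ge0// ltW.
have k1 : k < 1 by rewrite ltr_pdivrMr// mul1r ltrDl.
pose g x := (1 - l) *: f x + l *: z.
have Kg x : K x -> K (g x).
  by move=> Kx; apply: Kconv => //; [rewrite (ltW l0)|apply: Kf].
have Kg_iter n x : K x -> K (iter n g x).
  by move=> Kx; elim: n => //= n; apply: Kg.
(* Lowering the excess from [c] to [k * c] loses a multiple of [f y], which the anchor term in [z]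
   repays because [f y <= B z]; this balance dictates [k = B / (B + l)]. *)
have contr c x y : 0 <= c -> K x -> K y ->
    cone_le C x ((1 + c) *: y) -> cone_le C (g x) ((1 + k * c) *: g y).
  move=> c0 Kx Ky xy; have c1 : 0 < 1 + c by rewrite ltr_pwDl.
  have fxy : cone_le C (f x) ((1 + c) *: f y).
    rewrite -f_hom//; last exact: KC.
    by apply: f_mono => //; [apply: KC|apply: interior_coneZ => //; apply: KC].
  have l1' : 0 <= 1 - l by rewrite subr_ge0.
  have := proper_coneZ Cp l1' fxy.
  have clB : 0 <= c * l / (B + l) by rewrite !mulr_ge0 ?invr_ge0// ltW.
  have CB : C ((B *: z - f y) + l *: f y).
    apply: proper_coneD => //; first by apply: KB => //; apply: Kf.
    by apply: proper_coneZ => //; [apply: ltW|exact: interior_coneW (KC _ (Kf _ Ky))].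
  move=> /(proper_coneD Cp)/(_ (proper_coneZ Cp clB CB)).
  rewrite /cone_le /g; congr (C _); rewrite /k.
  by lin (f x) (f y) z; field; rewrite gt_eqF.
have iter_contr n x y : K x -> K y ->
    cone_le C (iter n g x) ((1 + B * k ^+ n) *: iter n g y).
  elim: n => [|n IH] Kx Ky /=.
    rewrite expr0 mulr1; apply: (cone_le_trans Cp (KB x y Kx Ky)).
    by apply: cone_leZl => //; [rewrite lerDr|exact: interior_coneW (KC _ Ky)].
  rewrite exprS mulrCA; apply: contr; try exact: Kg_iter; last exact: IH.
  by rewrite mulr_ge0 ?exprn_ge0// ltW.
(* The [+ 1] keeps the divisor positive even when [P = 0]; this [n] makes [P * k ^+ n < e / 2]. *)
have P1 : 0 < 2 * (P + 1) by rewrite mulr_gt0// ltr_wpDl.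
have [n nP] := le0_expr_lt k0 k1 (divr_gt0 e0 P1).
pose x := iter n g z; have Kx : K x by apply: Kg_iter.
exists x => //.
have kn0 : 0 <= k ^+ n by rewrite exprn_ge0.
(* [x] and [g x] are the [n]-th iterates of [z] and [g z], so the contraction estimate compares them
   in both directions. *)
have gx1 : `|x - g x| <= P * k ^+ n.
  have diff y y' : K y -> K y' -> cone_le C y ((1 + B * k ^+ n) *: y') ->
      cone_le C (y - y') ((B ^+ 2 * k ^+ n) *: v).
    move=> Ky Ky' yy'.
    have Bk0 : 0 <= B * k ^+ n by rewrite mulr_ge0// ltW.
    have := cone_leZ Cp Bk0 (proj2 (Kv _ Ky')).
    move=> /(proper_coneD Cp yy'); rewrite /cone_le; congr (C _).
    by lin y y' v; ring.
  have := nN (x - g x) ((B ^+ 2 * k ^+ n) *: v).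
  have gxE : g x = iter n g (g z) by rewrite -iterS iterSr.
  have h1 : cone_le C (x - g x) ((B ^+ 2 * k ^+ n) *: v).
    apply: diff => //; first exact: Kg.
    by rewrite gxE; apply: iter_contr => //; apply: Kg.
  have h2 : cone_le C (g x - x) ((B ^+ 2 * k ^+ n) *: v).
    apply: diff => //; first exact: Kg.
    by rewrite gxE; apply: iter_contr => //; apply: Kg.
  have h3 : cone_le C (- ((B ^+ 2 * k ^+ n) *: v)) (x - g x).
    move: h2; rewrite /cone_le opprK opprB addrC [x - g x + _]addrC.
    by congr (C _); rewrite addrC.
  move=> /(_ h3 h1).
  rewrite normrZ ger0_norm ?mulr_ge0// ?exprn_ge0 ?(ltW B0)//.
  by congr (_ <= _); rewrite /P; ring.
have gx2 : `|z - f x| <= P.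
  have Kfx := Kf _ Kx; have [vz zB] := Kv _ Kz; have [vf fB] := Kv _ Kfx.
  have BB : B <= B ^+ 2 by rewrite expr2 ler_pMr.
  have := nN (z - f x) (B ^+ 2 *: v).
  have h y y' : K y -> K y' -> cone_le C (y - y') (B ^+ 2 *: v).
    move=> /Kv[_ yB] /KC/interior_coneW Cy'.
    have := proper_coneD Cp (proper_coneD Cp yB Cy') (cone_leZl Cp BB Cv).
    by rewrite /cone_le; congr (C _); lin y y' v; ring.
  have h3 : cone_le C (- (B ^+ 2 *: v)) (z - f x).
    by have := h _ _ Kfx Kz; rewrite /cone_le; congr (C _); lin (f x) z v; ring.
  move=> /(_ h3 (h _ _ Kz Kfx)).
  by rewrite normrZ ger0_norm ?exprn_ge0// ltW.
have -> : x - f x = (x - g x) + l *: (z - f x).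
  by rewrite /g; lin (f x) x z; ring.
apply: (le_lt_trans (ler_normD _ _)); rewrite [e in _ < e]splitr.
apply: ltr_leD.
  apply: (le_lt_trans gx1); move: nP; rewrite ltr_pdivlMr// => nP.
  have : k ^+ n * (2 * (P + 1)) = 2 * (P * k ^+ n) + 2 * k ^+ n by ring.
  lra.
rewrite normrZ gtr0_norm//; apply: le_trans (ltW lP).
by apply: ler_wpM2l => //; apply: ltW.
Qed.

(** * Difference quotients of almost fixed points *)

Lemma semidifferentialP (R : realType) (X : normedModType R) (G : set X)
    (f h : X -> X) (v : X) (e : R) :
  is_semidifferential G f v h -> 0 < e ->
  \forall x \near (0 : X), `|f (v + x) - f v - h x| <= e * `|x|.
Proof.
case=> _ _ _ A1 e0.
have /eqadd_some_oP/(_ e e0) := funext A1.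
by apply: filterS => x /=; rewrite !fctE opprD addrA.
Qed.

(** With [x = v + t u], homogeneity of [h] and [f v = v] split [t (u - h u)] into [x - f x], of
    order [t^2], and the expansion error at [v], which is [o(t)] because [u] is bounded. Dividing by
    [t] gives the limit. *)
Lemma semidifferential_residual_cvg0 (R : realType) (X : normedModType R)
    (G : set X) (f h : X -> X) (v : X) (t : nat -> R) (u : nat -> X) (N : R) :
  is_semidifferential G f v h -> f v = v -> (forall n, 0 < t n) ->
  t n @[n --> \oo] --> 0 -> (forall n, `|u n| <= N) ->
  (forall n, `|v + t n *: u n - f (v + t n *: u n)| <= t n ^+ 2) ->
  (u n - h (u n)) @[n --> \oo] --> (0 : X).
Proof.
move=> A1 fv t0 tcvg uN fx; have [_ _ h_hom _] := A1.
have N0 : 0 <= N by apply: le_trans (uN 0%N).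
have tu0 : t n *: u n @[n --> \oo] --> (0 : X).
  apply/cvgr0Pnorm_lt => e e0.
  have N1 : 0 < N + 1 by rewrite ltr_wpDl.
  have /cvgr0Pnorm_lt/(_ _ (divr_gt0 e0 N1)) := tcvg.
  apply: filterS => n; rewrite ltr_pdivlMr// normrZ; apply: le_lt_trans.
  by apply: ler_wpM2l => //; apply: le_trans (uN n) _; rewrite lerDl.
apply/cvgr0Pnorm_le => e e0.
have N1 : 0 < 2 * (N + 1) by rewrite mulr_gt0// ltr_wpDl.
have A1e := semidifferentialP A1 (divr_gt0 e0 N1).
have e2 : 0 < e / 2 by rewrite divr_gt0.
have /cvgr0Pnorm_lt/(_ _ e2) tlt := tcvg.
have := tu0 _ A1e; rewrite /nbhs/= => A1n.
near=> n.
have h1 : `|f (v + t n *: u n) - f v - h (t n *: u n)| <=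
    e / (2 * (N + 1)) * `|t n *: u n|.
  by near: n.
have h2 : t n < e / 2.
  by apply: le_lt_trans (ler_norm _) _; near: n.
have t0n := t0 n.
rewrite -(@ler_pM2l _ (t n))// -[t n in leLHS]gtr0_norm// -normrZ.
have -> : t n *: (u n - h (u n)) =
    (v + t n *: u n - f (v + t n *: u n)) +
    (f (v + t n *: u n) - f v - h (t n *: u n)).
  rewrite h_hom// fv -[_ - v - _]addrA [RHS]addrA subrK.
  by lin (h (u n)) (u n) v; ring.
apply: (le_trans (ler_normD _ _)).
have -> : t n * e = t n * (e / 2) + t n * (e / 2) by field.
apply: lerD; first by apply: (le_trans (fx n)); rewrite expr2 ler_wpM2l//; apply: ltW.
apply: (le_trans h1); rewrite normrZ gtr0_norm// mulrCA.
apply: ler_wpM2l; first exact: ltW.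
rewrite [leLHS]mulrAC ler_pdivrMr// (_ : e / 2 * _ = e * (N + 1)); last by field.
apply: ler_wpM2l; first exact: ltW.
by apply: (le_trans (uN n)); rewrite lerDl.
Unshelve. all: by end_near.
Qed.

Lemma increasing_seq_cvg_infty (s : nat -> nat) :
  increasing_seq s -> s n @[n --> \oo] --> \oo.
Proof.
move=> s_incr; have s_ge n : (n <= s n)%N.
  elim: n => // n IH; apply: (leq_ltn_trans IH).
  by rewrite ltnNge -[(_ <= _)%N]/(s n.+1 <= s n)%O s_incr -ltnNge.
move=> A [n _ nA]; exists n => // m nm; apply: nA.
exact: leq_trans nm (s_ge m).
Qed.

(** * Contradiction from a tight pair of fixed points *)

Lemma tight_fixed_points_absurd (R : realType) (X : completeNormedModType R)
    (C : set X) (f f'v : X -> X) (v w : X) (c : R) :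
  normal_cone C ->
  positively_homogeneous (interior C) f ->
  order_preserving C (interior C) f ->
  is_semidifferential (interior C) f v f'v ->
  property_F setT (fun x => x - f'v x) ->
  (forall x, f'v x = x -> [set lambda *: v | lambda in [set: R]] x) ->
  v != 0 -> w != 0 -> interior C v -> interior C w -> f v = v -> f w = w ->
  cone_le C v w -> (forall a, cone_le C (a *: v) w -> a <= 1) ->
  0 < c -> cone_le C (c *: w) v -> (forall a, cone_le C (a *: w) v -> a <= c) ->
  ~ c < 1.
Proof.
move=> Cn f_hom f_mono A1 A2 A3 v0 w0 vC wC fv fw.
move=> vw vw_best c0 wv wv_best c1.
have [Cp _] := Cn; have [N N0 nN] := normal_cone_norm_le Cn.
have Cv := interior_coneW vC; have Cw := interior_coneW wC.
have cne : c != 0 by rewrite gt_eqF.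
(* This [d] satisfies [1 + d = c^-1], so that the segment point [(1 - s) v + s w] lies in [K s] for
   [0 < s <= 1]. The small parameter of the overview is [s * d]. *)
pose d := (1 - c) / c.
have d0 : 0 < d by rewrite divr_gt0// subr_gt0.
pose K (t : R) := [set x | [/\ cone_le C v x, cone_le C x w,
  cone_le C (((1 + t * d) * c) *: w) x & cone_le C x ((1 + t * d) *: v)]].
have KC t x : K t x -> interior C x.
  by case=> vx _ _ _; apply: interior_cone_le vC vx.
have f_scale a x : 0 < a -> interior C x -> f x = x -> f (a *: x) = a *: x.
  by move=> a0 xC fx; rewrite f_hom// fx.
have almost n : exists x,
    K (harmonic n) x /\ `|x - f x| <= (harmonic n * d) ^+ 2.
  have [s0 s1] : 0 < harmonic n :> R /\ harmonic n <= 1 :> R.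
    by rewrite /harmonic/= invr_gt0 invf_le1 ?ltr0n// ler1n.
  move: (harmonic n) s0 s1 => s s0 s1.
  have sd0 : 0 < 1 + s * d by rewrite addr_gt0// mulr_gt0.
  have Kz : K s ((1 - s) *: v + s *: w).
    have s01 : 0 <= s <= 1 by rewrite ltW.
    have s1' : 0 <= 1 - s by rewrite subr_ge0.
    split.
    - have := cone_le_conv Cp s01 (cone_le_refl Cp v) vw.
      by rewrite -scalerDl subrK scale1r.
    - have := cone_le_conv Cp s01 vw (cone_le_refl Cp w).
      by rewrite -[X in cone_le C _ X]scalerDl subrK scale1r.
    - have := cone_le_conv Cp s01 wv (cone_le_refl Cp w).
      rewrite /cone_le; congr (C _); rewrite /d.
      by lin v w (0 : X); field.
    - have sc0 : 0 <= s / c by rewrite divr_ge0// ltW.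
      have := cone_leZ Cp sc0 wv.
      rewrite /cone_le; congr (C _); rewrite /d.
      by lin v w (0 : X); field.
  have Kconv t x y : 0 <= t <= 1 -> K s x -> K s y ->
      K s ((1 - t) *: x + t *: y).
    move=> t01 [x1 x2 x3 x4] [y1 y2 y3 y4].
    have tt p : p = (1 - t) *: p + t *: p by rewrite -scalerDl subrK scale1r.
    split; [rewrite [v]tt|rewrite [w]tt|rewrite [X in cone_le C X _]tt|
      rewrite [X in cone_le C _ X]tt]; exact: cone_le_conv.
  (* Each of the four bounds is a positive multiple of [v] or [w], hence itself fixed by [f]. *)
  have Kf x : K s x -> K s (f x).
    move=> Kx; have xC := KC _ _ Kx; have [x1 x2 x3 x4] := Kx.
    have scale_c : 0 < (1 + s * d) * c by rewrite mulr_gt0.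
    split; [rewrite -fv|rewrite -fw|rewrite -(f_scale _ _ scale_c wC fw)|
      rewrite -(f_scale _ _ sd0 vC fv)];
    by apply: f_mono => //; apply: interior_coneZ.
  have cV : 1 <= c^-1 by rewrite invf_ge1// ltW.
  (* The ratio bound [c^-1] comes from [x <= w] and [c w <= v]. *)
  have KvB x : K s x -> cone_le C v x /\ cone_le C x (c^-1 *: v).
    case=> x1 x2 _ _; split=> //; apply: (cone_le_trans Cp x2).
    have ic0 : 0 <= c^-1 by rewrite invr_ge0 ltW.
    by have := cone_leZ Cp ic0 wv; rewrite scalerA mulVf// scale1r.
  have sd2 : 0 < (s * d) ^+ 2 by rewrite exprn_gt0// mulr_gt0.
  have [x Kx xfx] :=
    almost_fixed_point Cn f_hom f_mono vC cV KvB Kconv Kf Kz sd2.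
  by exists x; split=> //; apply: ltW.
have [x xP] := choice almost.
pose t (n : nat) : R := harmonic n * d.
have t0 n : 0 < t n by rewrite mulr_gt0// /harmonic/= invr_gt0 ltr0n.
pose u n := (t n)^-1 *: (x n - v).
have xE n : x n = v + t n *: u n.
  by rewrite /u scalerA divff ?gt_eqF// scale1r subrKC.
have t_cvg : t n @[n --> \oo] --> 0.
  by rewrite -(mul0r d); apply: cvgM; [exact: cvg_harmonic|exact: cvg_cst].
have u_ge0 n : C (u n).
  have [[x1 _ _ _] _] := xP n.
  by apply: (proper_coneZ Cp _ x1); rewrite invr_ge0 ltW.
have u_lev n : cone_le C (u n) v.
  have [[_ _ _ x4] _] := xP n; have ti : 0 <= (t n)^-1 by rewrite invr_ge0 ltW.
  have := cone_leZ Cp ti x4; rewrite /cone_le /u -/(t n); congr (C _).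
  by lin (x n) v (0 : X); field; rewrite gt_eqF.
have uN n : `|u n| <= N * `|v|.
  apply: nN => //; rewrite /cone_le opprK; exact: proper_coneD.
have res : (u n - f'v (u n)) @[n --> \oo] --> (0 : X).
  apply: (semidifferential_residual_cvg0 A1 fv t0 t_cvg uN) => n.
  by rewrite -xE; have [] := xP n.
have u_bounded : bounded_fun u.
  exists (N * `|v|); split; first exact: num_real.
  by move=> M NM n _; apply: le_trans (uN n) _; apply: ltW.
have [s s_incr us_cvg] := A2 u (fun=> I) u_bounded res.
pose y := lim (u \o s @ \oo).
have usy : (u \o s) n @[n --> \oo] --> y by [].
have s_cvg := increasing_seq_cvg_infty s_incr.
have [_ f'v_cont _ _] := A1.
have resy : ((u \o s) n - f'v ((u \o s) n)) @[n --> \oo] --> y - f'v y.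
  by apply: cvgB => //; apply: continuous_cvg => //; apply: f'v_cont.
have res0 : ((u \o s) n - f'v ((u \o s) n)) @[n --> \oo] --> (0 : X).
  exact: (cvg_comp _ _ s_cvg res).
have fy : f'v y = y.
  by apply/esym/eqP; rewrite -subr_eq0; apply/eqP; apply: cvg_unique resy res0.
have [lam _ lamE] := A3 _ fy.
have [k k0 kv] := order_unit Cp vC.
(* This closeness to the limit makes the order error [r] less than [1 / 2], which is incompatible
   with [lam <= r] and [1 <= lam + r]. *)
have k20 : 0 < (2 * k)^-1 by rewrite invr_gt0 mulr_gt0.
have /cvgrPdist_lt/(_ _ k20)[n _ /(_ n (leqnn n)) /=] := usy.
rewrite -lamE; move: (s n) => m um.
set r := k * `|lam *: v - u m|.
have r2 : r < 1 / 2.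
  have -> : 1 / 2 = k * (2 * k)^-1 by field; rewrite gt_eqF.
  by rewrite ltr_pM2l.
have [[x1 x2 x3 x4] _] := xP m; have tm := t0 m.
have lo : cone_le C ((1 + t m * (lam - r)) *: v) (x m).
  have := cone_leZ Cp (ltW tm) (kv (lam *: v - u m)).
  rewrite -/r xE /cone_le; congr (C _).
  by lin (u m) v (0 : X); ring.
have hi : cone_le C (x m) ((1 + t m * (lam + r)) *: v).
  have := cone_leZ Cp (ltW tm) (kv (u m - lam *: v)).
  rewrite distrC -/r xE /cone_le; congr (C _).
  by lin (u m) v (0 : X); ring.
have lam_le : lam - r <= 0.
  have := vw_best _ (cone_le_trans Cp lo x2).
  by rewrite gerDl pmulr_rle0.
pose q := 1 + t m * (lam + r).
have q1 : 1 <= q.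
  apply: (cone_leZl_inv Cp v0 vC); rewrite scale1r.
  exact: cone_le_trans x1 hi.
have q0 : 0 < q by apply: lt_le_trans q1.
(* From [(1 + t) c w <= x <= q v], optimality of [c] gives [(1 + t) c / q <= c], that is
   [1 + t <= q]. *)
have lam_ge : 1 <= lam + r.
  have iq0 : 0 <= q^-1 by rewrite invr_ge0 ltW.
  have := cone_leZ Cp iq0 (cone_le_trans Cp x3 hi).
  rewrite !scalerA mulVf ?gt_eqF// scale1r => /wv_best.
  rewrite mulrA -ler_pdivlMr// divff// mulrC ler_pdivrMr// mul1r.
  by rewrite /q lerD2l -/(t m) -[leLHS]mulr1 ler_pM2l.
move: r2; rewrite ltr_pdivlMr// mulr_natr mulr2n; apply/negP; rewrite -leNgt.
by apply: le_trans lam_ge _; rewrite lerD2r -subr_le0.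
Qed.

(** * The fixed points form a single ray *)

Theorem corollary7p7 (R : realType) (X : completeNormedModType R) (C : set X)
    (f : X -> X) (v : X) (f'v : X -> X)
    (C_normal : normal_cone C)
    (C_int : interior C !=set0)
    (f_int : forall x, interior C x -> interior C (f x))
    (f_hom : positively_homogeneous (interior C) f)
    (f_mono : order_preserving C (interior C) f)
    (vS : fixed_points (interior C) f v)
    (A1 : is_semidifferential (interior C) f v f'v)
    (A2 : property_F setT (fun x => x - f'v x))
    (A3 : forall x, f'v x = x -> [set lambda *: v | lambda in [set: R]] x) :
  fixed_points (interior C) f =
    [set lambda *: v | lambda in [set lambda : R | 0 < lambda]].
Proof.
have [Cp _] := C_normal; have [vC fv] := vS; have Cv := interior_coneW vC.
apply/seteqP; split=> [w [wC fw]|_ [a /= a0 <-]]; last first.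
  by split; [exact: interior_coneZ|rewrite f_hom// fv].
have Cw := interior_coneW wC.
(* If [0] is interior to [C], being an order unit it dominates every vector, so the pointed cone is
   trivial; the zero cases reduce to this. *)
have [v0|v0] := eqVneq v 0.
  exists 1; rewrite /= ?ltr01// scale1r v0.
  have [k k0 kv] := order_unit Cp vC.
  have := kv w; rewrite v0 scaler0 => w_le0.
  by apply: (cone_le_anti Cp) => //; rewrite /cone_le subr0.
have [w0|w0] := eqVneq w 0.
  have [k k0 kw] := order_unit Cp wC.
  have := kw v; rewrite w0 scaler0 => v_le0.
  suff : v = 0 by move/eqP: v0.
  by apply: (cone_le_anti Cp) => //; rewrite /cone_le subr0.
have [a [a0 aw aw_best]] := best_lower_scalar Cp v0 vC wC.
have ia0 : 0 < a^-1 by rewrite invr_gt0.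
have ane : a != 0 by rewrite gt_eqF.
(* Rescaling makes [1] the optimal scalar in [v <= w']. The tight-pair contradiction then forces
   [c >= 1], so [w' <= c w' <= v] and the two points coincide. *)
pose w' := a^-1 *: w.
have w'C : interior C w' by exact: interior_coneZ.
have w'0 : w' != 0 by rewrite scaler_eq0 negb_or invr_neq0.
have fw' : f w' = w' by rewrite /w' f_hom// fw.
have vw : cone_le C v w'.
  by have := cone_leZ Cp (ltW ia0) aw; rewrite scalerA mulVf// scale1r.
have vw_best b : cone_le C (b *: v) w' -> b <= 1.
  move=> /(cone_leZ Cp (ltW a0)); rewrite !scalerA mulfV// scale1r => /aw_best.
  by rewrite -ler_pdivlMl// mulVf.
have [c [c0 wv wv_best]] := best_lower_scalar Cp w'0 w'C vC.
have c1 : 1 <= c.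
  rewrite leNgt; apply/negP.
  exact: (@tight_fixed_points_absurd _ _ C f f'v v w' c).
exists a => //; suff -> : v = w' by rewrite /w' scalerA divff// scale1r.
apply: (cone_le_anti Cp) => //; apply: cone_le_trans wv => //.
rewrite -[X in cone_le C X _]scale1r.
by apply: cone_leZl => //; apply: interior_coneW.
Qed.
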